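(* Let $d\geq 2$ be an integer and let $n$ and $k$ be positive integers such that $n<d^{k+1}$. Then the number $p_d(n)$ of $d$-ary partitions of $n$ is $$p_d(n)=\frac{1}{k!} \sum_{\substack{0\leq j_1\leq d^{k}-1,\; 0\leq j_2\leq d^{k-1}-1,\; \ldots,\; 0\leq j_{k} \leq d-1 \\ j_1+j_2d+\cdots+j_kd^{k-1} \equiv n \pmod{d^k}}} \prod_{\ell=1}^{k} \left(\frac{n-j_{1}- j_2 d- \cdots -j_k d^{k-1}}{d^k}+\ell \right),$$ where the sum runs over integer tuples $(j_1,\ldots,j_k)$ with $0\leq j_i\leq d^{k+1-i}-1$ for $1\leq i\leq k$.
   Context: A partition of a positive integer $n$ is a non-increasing sequence of positive integers (its parts) summing to $n$. For an integer $d\geq 2$, a partition is $d$-ary if all of its parts are powers of $d$ (including $d^0=1$). $p_d(n)$ denotes the number of $d$-ary partitions of $n$. *)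

(* Defs.v *)
From mathcomp Require Import all_boot all_order all_algebra.

Set Implicit Arguments.
Unset Strict Implicit.
Unset Printing Implicit Defensive.

Definition is_partition (n : nat) (s : seq nat) : bool :=
  [&& sorted geq s, all (fun x => 0 < x) s & sumn s == n].

(* The bound on the exponent loses nothing when d >= 2, see [is_powP]. *)
Definition is_pow (d x : nat) : bool := [exists i : 'I_x.+1, x == d ^ i].

Definition is_dary_partition (d n : nat) (s : seq nat) : bool :=
  is_partition n s && all (is_pow d) s.

(* A partition of n has at most n parts, each at most n, so all of them live
   in the finite type of sequences of length <= n over {0, ..., n}; see
   [mem_dary_partitions] for the proof that none is missed. *)
Definition dary_partitions (d n : nat) : {set n.-bseq 'I_n.+1} :=
  [set s : n.-bseq 'I_n.+1 | is_dary_partition d n (map val s)].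

Definition pd (d n : nat) : nat := #|dary_partitions d n|.

Lemma is_powP (d x : nat) :
  1 < d -> reflect (exists i, x = d ^ i) (is_pow d x).
Proof.
move=> d_gt1; apply: (iffP existsP) => [[i /eqP->]|[i ->]]; first by exists i.
have lt_i : i < (d ^ i).+1 by rewrite ltnS ltnW // ltn_expl.
by exists (Ordinal lt_i).
Qed.

Lemma partition_bounds (n : nat) (s : seq nat) :
  is_partition n s -> size s <= n /\ all (fun x => x < n.+1) s.
Proof.
case/and3P=> _ + /eqP <- {n}; elim: s => //= x s IHs /andP[x_gt0 /IHs[le_s lt_s]].
split; first by rewrite -add1n leq_add.
rewrite ltnS leq_addr /=; apply: sub_all lt_s => y; rewrite !ltnS => le_y.
exact: leq_trans le_y (leq_addl _ _).
Qed.

Lemma mem_dary_partitions (d n : nat) (s : seq nat) :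
  is_dary_partition d n s <->
  exists! b : n.-bseq 'I_n.+1, b \in dary_partitions d n /\ map val b = s.
Proof.
split=> [sP|[b [[+ <-] _]]]; last by rewrite inE.
have [le_s lt_s] := partition_bounds (andP sP).1.
pose t : seq 'I_n.+1 := map inord s.
have tE : map val t = s.
  rewrite -map_comp map_id_in // => x /(allP lt_s) x_lt /=.
  exact: inordK.
have le_t : size t <= n by rewrite size_map.
exists (Bseq le_t); split; first by rewrite inE /= tE.
move=> b [_ bE]; apply: val_inj; apply: (inj_map val_inj).
by rewrite /= tE bE.
Qed.

(* Main.v *)
(** Since n < d^(k+1), a d-ary partition of n amounts to multiplicities
    m_0, ..., m_k with sum_i m_i d^i = n.  For i < k, divide m_i by d^(k-i):
    m_i = j_i + q_i d^(k-i), and put q_k = m_k.  The equation becomes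
    n = S + M d^k, where S = sum_(i < k) j_i d^i and M = q_0 + ... + q_k, so
    each admissible residue vector j with S <= n contributes
    'C(M + k, k) = (1 / k!) prod_(1 <= l <= k) (M + l) partitions.  The vectors
    with S > n come from no partition, and S < k d^k forces -k < M < 0 for
    M = (n - S) / d^k, so their product has a zero factor. *)
Require Import Defs.
From mathcomp Require Import all_boot all_order all_algebra.
Import GRing.Theory Num.Theory.
Local Open Scope ring_scope.

Section Count.
Set Implicit Arguments.
Unset Strict Implicit.
Local Open Scope nat_scope.
Implicit Types (d n k : nat) (s : seq nat).

Lemma sumn_count_pow d K s :
    1 < d -> all (fun x => [exists i : 'I_K, x == d ^ i]) s ->
  sumn s = \sum_(i < K) count_mem (d ^ i) s * d ^ i.
Proof.
move=> d_gt1; elim: s => [|x s IHs] /=; first by rewrite big1.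
case/andP=> /existsP[e /eqP ->] /IHs ->.
under [RHS]eq_bigr do rewrite mulnDl.
rewrite big_split /=; congr (_ + _).
rewrite (bigD1 e) //= eqxx mul1n big1 ?addn0 // => i ne_ie.
by rewrite eqn_exp2l // (inj_eq val_inj) eq_sym (negPf ne_ie).
Qed.

(** A part [d ^ e] is at most [n < d ^ k.+1], so its exponent is at most [k]. *)
Lemma dary_parts_bounded d n k s :
    1 < d -> n < d ^ k.+1 -> is_dary_partition d n s ->
  all (fun x => [exists i : 'I_k.+1, x == d ^ i]) s.
Proof.
move=> d_gt1 n_lt /andP[/partition_bounds[_ /allP s_le] /allP s_pow].
apply/allP=> x xs; have /(is_powP _ d_gt1)[e xE] := s_pow x xs.
have e_lt : e < k.+1.
  by rewrite -(ltn_exp2l _ _ d_gt1) -xE (leq_ltn_trans _ n_lt) // -ltnS s_le.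
by apply/existsP; exists (Ordinal e_lt); rewrite xE.
Qed.

Definition pow_seq d K (m : 'I_K -> nat) : seq nat :=
  sort geq (flatten [seq nseq (m i) (d ^ i) | i : 'I_K]).

Lemma count_pow_seq d K (m : 'I_K -> nat) (i : 'I_K) :
  1 < d -> count_mem (d ^ i) (pow_seq d m) = m i.
Proof.
move=> d_gt1; rewrite count_sort count_flatten -map_comp sumnE big_map big_enum.
rewrite /= (bigD1 i) //= count_nseq /= eqxx mul1n big1 ?addn0 // => e ne_ei.
by rewrite count_nseq /= eqn_exp2l // (inj_eq val_inj) (negPf ne_ei).
Qed.

Lemma pow_seq_dary d n K (m : 'I_K -> nat) :
  1 < d -> \sum_(i < K) m i * d ^ i = n -> is_dary_partition d n (pow_seq d m).
Proof.
move=> d_gt1 mE; have mem_pow x : x \in pow_seq d m -> exists i, x = d ^ i.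
  rewrite mem_sort => /flattenP[_ /mapP[i _ ->]].
  by rewrite mem_nseq => /andP[_ /eqP->]; exists i.
apply/andP; split; last by apply/allP=> x /mem_pow xP; apply/is_powP.
apply/and3P; split.
- by apply: sort_sorted => x y; apply: leq_total.
- by apply/allP=> x /mem_pow[i ->]; rewrite expn_gt0 ltnW.
- rewrite (@sumn_count_pow d K) //; last first.
    apply/allP=> x; rewrite mem_sort => /flattenP[_ /mapP[i _ ->]].
    by rewrite mem_nseq => /andP[_ /eqP->]; apply/existsP; exists i.
  by rewrite -mE; apply/eqP/eq_bigr => i _; rewrite count_pow_seq.
Qed.

(** Vectors of multiplicities. For [0 < d] the bound [m i <= n] excludes none of them, since
    [m i <= m i * d ^ i <= n]. *)
Definition pow_sums d K n : {set {ffun 'I_K -> 'I_n.+1}} :=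
  [set m : {ffun 'I_K -> 'I_n.+1} | \sum_(i < K) m i * d ^ i == n].

(** The bijection sends a partition to its multiplicities: a sorted sequence is determined by them,
    and [pow_seq] provides a preimage. *)
Lemma pd_pow_sums d n k :
  1 < d -> n < d ^ k.+1 -> pd d n = #|pow_sums d k.+1 n|.
Proof.
move=> d_gt1 n_lt.
pose mult (b : n.-bseq 'I_n.+1) : {ffun 'I_k.+1 -> 'I_n.+1} :=
  [ffun i : 'I_k.+1 => inord (count_mem (d ^ i) (map val b))].
have multE b (i : 'I_k.+1) : mult b i = count_mem (d ^ i) (map val b) :> nat.
  rewrite ffunE inordK // ltnS (leq_trans (count_size _ _)) // size_map.
  exact: size_bseq.
rewrite /pd -(@card_in_imset _ _ mult); last first.
  move=> b c; rewrite !inE => bP cP eq_bc.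
  apply/val_inj/(inj_map val_inj)/(@sorted_eq _ geq) => /=.
  - by move=> y x z /= xy yz; apply: leq_trans yz xy.
  - by move=> x y; rewrite /= andbC => /anti_leq.
  - by case/andP: bP => /andP[].
  - by case/andP: cP => /andP[].
  apply/allP=> x; rewrite mem_cat => x_bc.
  have [i ->] : exists i : 'I_k.+1, x = d ^ i.
    by case/orP: x_bc => x_s; [move: bP | move: cP];
      move=> /(dary_parts_bounded d_gt1 n_lt)/allP/(_ x x_s)/existsP[i /eqP->];
      exists i.
  by rewrite /= -!multE eq_bc.
apply: eq_card => m; apply/imsetP/idP => [[b + ->]|].
  rewrite !inE => bP; have := dary_parts_bounded d_gt1 n_lt bP.
  move/(sumn_count_pow d_gt1) => sumE; under eq_bigr do rewrite multE.
  by rewrite -sumE; case/andP: bP => /and3P[].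
rewrite inE => /eqP mE.
have /mem_dary_partitions[b [[bP bE] _]] := pow_seq_dary d_gt1 mE.
exists b => //; apply/ffunP=> i; apply/val_inj.
by rewrite /= multE bE (@count_pow_seq d k.+1 (fun i => m i)).
Qed.

Lemma residue_subproof d k (i : 'I_k) a : 0 < d -> a %% d ^ (k - i) < d ^ k.
Proof.
move=> d_gt0; apply: leq_trans (ltn_pmod _ _) _; first by rewrite expn_gt0 d_gt0.
by rewrite leq_pexp2l // leq_subr.
Qed.

(** The common codomain ['I_(d ^ k)] avoids dependent functions; the sharper bound [d ^ (k - i)] is
    kept as a separate condition. *)
Definition residue d k (d_gt0 : 0 < d) (m : 'I_k.+1 -> nat) :
    {ffun 'I_k -> 'I_(d ^ k)} :=
  [ffun i : 'I_k =>
     Ordinal (residue_subproof i (m (widen_ord (leqnSn k) i)) d_gt0)].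

(** Taking quotients by [d ^ (k - i)] identifies the fiber with the [k.+1]-tuples of naturals of sum
    [M], counted by stars and bars. *)
Lemma card_residue_fiber d n k (d_gt0 : 0 < d)
    (j : {ffun 'I_k -> 'I_(d ^ k)}) M :
    (forall i : 'I_k, j i < d ^ (k - i)) ->
    n = \sum_(i < k) j i * d ^ i + M * d ^ k ->
  #|[set m in pow_sums d k.+1 n | residue d_gt0 (fun i => m i) == j]|
    = 'C(M + k, k).
Proof.
move=> j_lt nE; rewrite addnC -card_ord_partitions.
(* [r] extends [j] by [0] at the top exponent [k], where d^(k-k) = 1. *)
pose r (i : 'I_k.+1) := if unlift ord_max i is Some i' then j i' : nat else 0.
have rw i : r (widen_ord (leqnSn k) i) = j i.
  have -> : widen_ord (leqnSn k) i = lift ord_max i.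
    by apply: val_inj; rewrite /= /bump leqNgt ltn_ord.
  by rewrite /r liftK.
have rmax : r ord_max = 0 by rewrite /r unlift_none.
pose f (q : k.+1.-tuple 'I_M.+1) : {ffun 'I_k.+1 -> 'I_n.+1} :=
  [ffun i : 'I_k.+1 => inord (r i + tnth q i * d ^ (k - i))].
(* As [d ^ (k - i) * d ^ i = d ^ k], a quotient contributes the same multiple of [d ^ k] at every
   exponent. *)
have splitE (q : 'I_k.+1 -> nat) :
    \sum_(i < k.+1) (r i + q i * d ^ (k - i)) * d ^ i =
    \sum_(i < k) j i * d ^ i + (\sum_(i < k.+1) q i) * d ^ k.
  under eq_bigr => i _.
    rewrite mulnDl -mulnA -expnD subnK -1?ltnS //; over.
  rewrite big_split -big_distrl big_ord_recr /= rmax mul0n addn0.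
  by under eq_bigr do rewrite rw.
(* This keeps [inord] in [f] away from its default value. *)
have le_term (q : 'I_k.+1 -> nat) (i : 'I_k.+1) :
    \sum_(i < k.+1) q i = M -> r i + q i * d ^ (k - i) <= n.
  move=> qM; rewrite nE -qM -splitE (bigD1 i) //= (leq_trans _ (leq_addr _ _)) //.
  by rewrite leq_pmulr // expn_gt0 d_gt0.
have fE (q : k.+1.-tuple 'I_M.+1) i : \sum_(i <- q) i = M :> nat ->
    f q i = r i + tnth q i * d ^ (k - i) :> nat.
  move=> qM; rewrite ffunE inordK // ltnS (le_term (fun i => tnth q i)) //.
  by rewrite -[RHS]qM big_tuple.
rewrite -[RHS](@card_in_imset _ _ f); last first.
  move=> p q; rewrite !inE => /eqP pM /eqP qM eq_f; apply: eq_from_tnth => i.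
  have /eqP := congr1 (fun m : {ffun 'I_k.+1 -> 'I_n.+1} => m i : nat) eq_f.
  by rewrite /= !fE // eqn_add2l eqn_pmul2r ?expn_gt0 ?d_gt0 // => /eqP/val_inj.
apply: eq_card => m; apply/idP/imsetP.
  rewrite !inE => /andP[/eqP mE /eqP jE].
  (* The preimage of [m] under [f]; at [i = k] the divisor is 1, so the quotient is [m k] itself. *)
  pose q i := (m i : nat) %/ d ^ (k - i).
  have mq i : m i = r i + q i * d ^ (k - i) :> nat.
    rewrite [LHS](divn_eq _ (d ^ (k - i))) addnC; congr (_ + _).
    case: (unliftP ord_max i) => [i' ->|->]; last first.
      by rewrite /= subnn modn1 rmax.
    have -> : lift ord_max i' = widen_ord (leqnSn k) i'.
      by apply: val_inj; rewrite /= /bump leqNgt ltn_ord.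
    by rewrite rw -jE ffunE.
  have qM : \sum_(i < k.+1) q i = M.
    apply/eqP; rewrite -(@eqn_pmul2r (d ^ k)) ?expn_gt0 ?d_gt0 //.
    rewrite -(eqn_add2l (\sum_(i < k) j i * d ^ i)) -nE -splitE -[X in _ == X]mE.
    by apply/eqP/eq_bigr => i _; rewrite mq.
  have q_lt i : q i < M.+1 by rewrite ltnS -qM (bigD1 i) //= leq_addr.
  have tM : \sum_(i <- [tuple inord (q i) : 'I_M.+1 | i < k.+1]) i = M :> nat.
    rewrite -[RHS]qM big_tuple; apply: eq_bigr => i _.
    by rewrite tnth_mktuple inordK.
  exists [tuple inord (q i) | i < k.+1]; first by rewrite inE tM.
  apply/ffunP=> i; apply: val_inj.
  by rewrite /= fE // tnth_mktuple inordK // -mq.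
case=> q; rewrite inE => /eqP qM ->; rewrite !inE; apply/andP; split.
  have qs : \sum_(i < k.+1) tnth q i = M :> nat by rewrite -[RHS]qM big_tuple.
  by under eq_bigr do rewrite fE //; rewrite splitE qs -nE.
apply/eqP/ffunP=> i; apply: val_inj; rewrite ffunE /= fE // rw /=.
by rewrite addnC modnMDl modn_small.
Qed.

(** Reducing the multiplicities removes a nonnegative multiple of [d ^ k] from [n], which gives both
    the inequality and the congruence. *)
Lemma residue_pow_sums d n k (d_gt0 : 0 < d) (m : {ffun 'I_k.+1 -> 'I_n.+1}) :
    m \in pow_sums d k.+1 n ->
  let j := residue d_gt0 (fun i => m i) in
  [/\ forall i : 'I_k, j i < d ^ (k - i),
      \sum_(i < k) j i * d ^ i <= n
    & \sum_(i < k) j i * d ^ i = n %[mod d ^ k]].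
Proof.
rewrite inE => /eqP mE j.
pose w (i : 'I_k) := m (widen_ord (leqnSn k) i) : nat.
have jE i : j i = w i %% d ^ (k - i) :> nat by rewrite ffunE.
have nE : n = (\sum_(i < k) w i %/ d ^ (k - i) + m ord_max) * d ^ k
              + \sum_(i < k) j i * d ^ i.
  rewrite -{1}mE big_ord_recr /= mulnDl addnAC; congr (_ + _).
  rewrite big_distrl -big_split; apply: eq_bigr => i _ /=.
  rewrite -/(w i) {1}(divn_eq (w i) (d ^ (k - i))) mulnDl -jE -mulnA -expnD subnK //.
  exact: ltnW.
split; last by rewrite nE modnMDl.
- by move=> i; rewrite jE ltn_pmod // expn_gt0 d_gt0.
- by rewrite [X in _ <= X]nE leq_addl.
Qed.

End Count.

(** Both sides equal [(M + k)! / M!]. *)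
Lemma prod_shift_bin (M k : nat) :
  \prod_(1 <= l < k.+1) (M%:R + l%:R) = (k`! * 'C(M + k, k))%:R :> rat.
Proof.
have prodE : (\prod_(1 <= l < k.+1) (M + l) * M`!)%N = (M + k)`!.
  elim: k => [|k IHk]; first by rewrite big_geq // mul1n addn0.
  by rewrite big_nat_recr //= mulnAC IHk addnS factS mulnC.
have -> : (k`! * 'C(M + k, k))%N = (\prod_(1 <= l < k.+1) (M + l))%N.
  apply/eqP; rewrite -(eqn_pmul2r (fact_gt0 M)) prodE -(bin_fact (leq_addl M k)).
  by rewrite addnK mulnAC mulnC [(k`! * M`!)%N]mulnC mulnA mulnAC.
by rewrite natr_prod; apply: eq_bigr => l _; rewrite natrD.
Qed.

(* j i (i = 0, ..., k-1) is the paper's j_{i+1}, so its range is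
   0 <= j_{i+1} <= d^{k+1-(i+1)} - 1 = d^{k-i} - 1. *)
Theorem theorem3p5 (d n k : nat) :
  (2 <= d)%N -> (0 < n)%N -> (0 < k)%N -> (n < d ^ k.+1)%N ->
  (pd d n)%:R =
    (k`!)%:R^-1 *
    \sum_(j : {ffun 'I_k -> 'I_(d ^ k)} |
            [forall i : 'I_k, (j i < d ^ (k - i))%N]
            && (\sum_(i < k) j i * d ^ i == n %[mod d ^ k])%N)
       \prod_(1 <= l < k.+1)
          ((n%:R - \sum_(i < k) (j i)%:R * d%:R ^+ i) / d%:R ^+ k + l%:R)
  :> rat.
Proof.
move=> d_gt1 _ _ n_lt; have d_gt0 := ltnW d_gt1.
have dk_gt0 : (0 < d ^ k)%N by rewrite expn_gt0 d_gt0.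
have dk_neq0 : (d ^ k)%:R != 0 :> rat by rewrite pnatr_eq0 -lt0n.
rewrite (pd_pow_sums d_gt1 n_lt) -sum1_card.
rewrite (partition_big (fun m : {ffun 'I_k.+1 -> 'I_n.+1} =>
           residue d_gt0 (fun i => m i))
  (fun j => [forall i : 'I_k, (j i < d ^ (k - i))%N]
            && (\sum_(i < k) j i * d ^ i == n %[mod d ^ k])%N)) /=; last first.
  move=> m /(residue_pow_sums d_gt0)[j_lt _ j_mod].
  by apply/andP; split; [apply/forallP | apply/eqP].
rewrite natr_sum big_distrr /=; apply: eq_bigr => j /andP[/forallP j_lt /eqP j_mod].
rewrite sum1dep_card -/(pow_sums d k.+1 n).
set S := (\sum_(i < k) j i * d ^ i)%N in j_mod.
have -> : \sum_(i < k) (j i)%:R * d%:R ^+ i = S%:R :> rat.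
  by rewrite natr_sum; apply: eq_bigr => i _; rewrite natrM natrX.
rewrite -natrX.
have [le_Sn | lt_nS] := leqP S n.
  have [M nE] : exists M, n = (S + M * d ^ k)%N.
    move/eqP: j_mod; rewrite eq_sym eqn_mod_dvd // => /dvdnP[M ME].
    by exists M; rewrite -ME subnKC.
  rewrite (card_residue_fiber d_gt0 j_lt nE).
  have -> : n%:R - S%:R = (M * d ^ k)%:R :> rat.
    by rewrite nE natrD addrC addKr.
  rewrite natrM mulfK //.
  by rewrite prod_shift_bin natrM mulKf // pnatr_eq0 -lt0n fact_gt0.
have [M SE] : exists M, S = (n + M * d ^ k)%N.
  move/eqP: j_mod; rewrite eqn_mod_dvd 1?ltnW // => /dvdnP[M ME].
  by exists M; rewrite -ME subnKC // ltnW.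
(* Here the numerator is [- M d^k] with [0 < M <= k], so the factor [l = M]
   vanishes, matching the empty fiber. *)
have M_gt0 : (0 < M)%N by case: M SE lt_nS => // ->; rewrite mul0n addn0 ltnn.
(* Each of the [k] terms of [S] is at most [d ^ (k - i) * d ^ i = d ^ k], so
   [M * d ^ k <= S <= k * d ^ k]. *)
have M_le : (M <= k)%N.
  rewrite -(leq_pmul2r dk_gt0) (leq_trans (leq_addl n _)) // -SE.
  rewrite -[X in (_ <= X * _)%N]card_ord -sum_nat_const leq_sum // => i _.
  rewrite (leq_trans (leq_mul (ltnW (j_lt i)) (leqnn _))) //.
  by rewrite -expnD subnK // ltnW.
rewrite (big_rem M) /=; last first.
  by rewrite mem_index_iota M_gt0 ltnS.
have -> : n%:R - S%:R = - (M * d ^ k)%:R :> rat.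
  by rewrite SE natrD opprD addrA subrr add0r.
rewrite natrM mulNr mulfK // addNr mul0r mulr0.
(* An element of this fiber would force [S <= n]. *)
apply/eqP; rewrite pnatr_eq0 cards_eq0; apply/eqP/setP => m; rewrite !inE.
apply/negP => /andP[mE /eqP jE].
have mP : m \in pow_sums d k.+1 n by rewrite inE.
have [_ + _] := residue_pow_sums d_gt0 mP.
by rewrite jE -/S leqNgt lt_nS.
Qed.
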